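(* Let $\Omega=\Omega(A)$ be a differential graded algebra on an algebra $A$ over a field $k$, and let $0\ne\lambda\in k$. Let $\Delta:\Omega\to\Omega$ be a linear map of degree $0$ and $[\![\ ,\ ]\!]:\Omega\otimes\Omega\to\Omega$ a bilinear map of degree $-1$. Then $$\omega\cdot\eta=\omega\eta-\tfrac{\lambda}{2}\theta'[\![\omega,\eta]\!],\qquad \mathrm d_\cdot\omega=\mathrm d\omega-\tfrac\lambda2\theta'\Delta\omega,\qquad\omega,\eta\in\Omega,$$ define a central extension of $\Omega$ if and only if $[\Delta,\mathrm d]=0$ and for all $\omega,\eta,\zeta\in\Omega$ $$[\![\omega\eta,\zeta]\!]+[\![\omega,\eta]\!]\zeta=[\![\omega,\eta\zeta]\!]+(-1)^{|\omega|}\omega[\![\eta,\zeta]\!],$$ $$L_\Delta(\omega,\eta)=\mathrm d[\![\omega,\eta]\!]+[\![\mathrm d\omega,\eta]\!]+(-1)^{|\omega|}[\![\omega,\mathrm d\eta]\!].$$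
   Context: $k$ has characteristic $\neq2$. A DGA on $A$ is an associative graded algebra $\Omega=\oplus_{n\ge0}\Omega^n$ with $\Omega^0=A$ and a graded derivation $\mathrm d:\Omega^n\to\Omega^{n+1}$ with $\mathrm d^2=0$. For a degree $0$ map, $L_\Delta(\omega,\eta)=\Delta(\omega\eta)-(\Delta\omega)\eta-\omega\Delta\eta$. A bilinear map of degree $-1$ sends $\Omega^m\otimes\Omega^n$ to $\Omega^{m+n-1}$. Let $\Omega_{\theta'}=k[\theta']/\langle\theta'^2\rangle$, a DGA with $\theta'$ of degree 1 and $\mathrm d\theta'=0$. A central extension of $\Omega(A)$ is a DGA $\tilde\Omega(A)$ which equals $\Omega_{\theta'}\otimes\Omega(A)$ as a vector space, such that the canonical inclusion $\Omega_{\theta'}\to\tilde\Omega(A)$ and the projection $\tilde\Omega(A)\to\Omega(A)$ setting $\theta'=0$ are maps of DGAs, and with $\theta'$ graded-central: $\theta'\omega=(-1)^{|\omega|}\omega\theta'$ for $\omega\in\Omega(A)$ (so $\theta'\cdot\omega=\theta'\otimes\omega$). Its product is denoted $\cdot$ and its differential $\mathrm d_\cdot$; these are determined by the displayed formulas on $\Omega(A)$ together with $\theta'^2=0$, $\mathrm d_\cdot\theta'=0$, graded-centrality of $\theta'$, and (for $\mathrm d_\cdot$) the graded Leibniz rule. *)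

(* Defs.v *)
From HB Require Import structures.
From mathcomp Require Import all_boot all_order all_algebra.

Set Implicit Arguments.
Unset Strict Implicit.
Unset Printing Implicit Defensive.

Import GRing.Theory.
Local Open Scope ring_scope.

(* A DGA on A. The grading is internal: every element is a finite sum of
   homogeneous components (dga_decomp) in only one way (dga_direct); the default
   value 0 of s`_i is harmless since 0 lies in every graded piece. The algebra A
   is identified with the piece of degree 0 by the embedding dga_iota.
   Algebras are unital and, as everywhere in MathComp, nonzero. *)
Record dga (k : fieldType) (A : algType k) := Dga {
  dga_alg :> algType k;
  dga_gr : nat -> {pred dga_alg};
  dga_d : {linear dga_alg -> dga_alg};
  dga_iota : {lrmorphism A -> dga_alg};
  dga_gr_submod : forall n, submod_closed (dga_gr n);
  dga_decomp : forall w : dga_alg, exists s : seq dga_alg,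
    (forall i, s`_i \in dga_gr i) /\ w = \sum_(i < size s) s`_i;
  dga_direct : forall s : seq dga_alg,
    (forall i, s`_i \in dga_gr i) -> \sum_(i < size s) s`_i = 0 ->
    forall i, s`_i = 0;
  dga_mul_gr : forall m n w v,
    w \in dga_gr m -> v \in dga_gr n -> w * v \in dga_gr (m + n)%N;
  dga_iota_inj : injective dga_iota;
  dga_gr0P : forall w, w \in dga_gr 0 <-> exists a : A, w = dga_iota a;
  dga_d_gr : forall n w, w \in dga_gr n -> dga_d w \in dga_gr n.+1;
  dga_leibniz : forall m w v, w \in dga_gr m ->
    dga_d (w * v) = dga_d w * v + (-1) ^+ m * (w * dga_d v);
  dga_dd : forall w, dga_d (dga_d w) = 0
}.

Arguments dga_gr {k A} Om n : rename.
Arguments dga_d {k A} Om : rename.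
Arguments dga_iota {k A} Om : rename.

Definition is_dga_map (k : fieldType) (A B : algType k) (X : dga A) (Y : dga B)
    (f : X -> Y) : Prop :=
  [/\ linear f, monoid_morphism f,
      forall n w, w \in dga_gr X n -> f w \in dga_gr Y n
    & forall w, f (dga_d X w) = dga_d Y (f w)].

(* The graded piece of degree n - 1, which is zero for n = 0. *)
Definition dga_gr_pred (k : fieldType) (A : algType k) (Om : dga A) (n : nat) :
    {pred Om} :=
  if n is n'.+1 then dga_gr Om n' else pred1 0.

Arguments dga_gr_pred {k A} Om n.

Section Theta.
Variable k : fieldType.

Definition theta_alg : algType k := {poly %/ ('X^2 : {poly k})}.
Definition theta : theta_alg := 'qX.
Definition theta_coef (s : theta_alg) (n : nat) : k := (s : {poly %/ 'X^2})`_n.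

(* The line spanned by theta ^+ n, which is zero for n >= 2. *)
Definition theta_gr (n : nat) : {pred theta_alg} :=
  [pred s | s == theta_coef s n *: theta ^+ n].

Definition theta_iota (c : k^o) : theta_alg := in_alg theta_alg c.

Fact theta_iota_linear : linear theta_iota.
Proof. by move=> a x y; rewrite /theta_iota /= scalerDl scalerA. Qed.

Fact theta_iota_monoid_morphism : monoid_morphism theta_iota.
Proof. by split=> [|x y]; [exact: (rmorph1 (in_alg _)) | exact: rmorphM]. Qed.

HB.instance Definition _ :=
  GRing.isLinear.Build k k^o theta_alg _ theta_iota theta_iota_linear.
HB.instance Definition _ :=
  GRing.isMonoidMorphism.Build k^o theta_alg theta_iota
    theta_iota_monoid_morphism.

Fact theta_coef_ge2 s n : (1 < n)%N -> theta_coef s n = 0.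
Proof.
move=> n_gt1; rewrite /theta_coef nth_default //.
apply: leq_trans n_gt1; rewrite -ltnS.
apply: leq_trans (size_mk_monic (s : {poly %/ 'X^2})) _.
by rewrite mk_monic_Xn size_polyXn.
Qed.

Fact theta_coefP s t : (theta_coef s =1 theta_coef t) <-> s = t.
Proof. exact: (@npolyP k _ s t). Qed.

Fact theta_coef0 n : theta_coef 0 n = 0.
Proof. by rewrite /theta_coef coef0. Qed.

Fact theta_coefD s t n : theta_coef (s + t) n = theta_coef s n + theta_coef t n.
Proof. by rewrite /theta_coef coefD. Qed.

Fact theta_coefZ a s n : theta_coef (a *: s) n = a * theta_coef s n.
Proof. by rewrite /theta_coef coefZ. Qed.

Fact theta_coef1 n : theta_coef 1 n = (n == 0)%:R.
Proof. by rewrite /theta_coef; case: n => [|n]; rewrite coefC. Qed.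

Fact theta_coef_theta n : theta_coef theta n = (n == 1)%:R.
Proof.
by rewrite /theta_coef /theta qpolyXE ?coefX ?size_polyXn ?monicXn.
Qed.

Fact theta_sqr : theta ^+ 2 = 0.
Proof.
apply: (etrans (esym (rmorphXn (in_qpoly ('X^2 : {poly k})) 2 'X))).
apply: (@val_inj _ _ {poly_(_) k}); rewrite /= mk_monic_Xn.
exact: Pdiv.RingMonic.rmodpp (monicXn _ _).
Qed.

Fact theta_decomp s : s = theta_coef s 0 *: 1 + theta_coef s 1 *: theta.
Proof.
apply/theta_coefP => n.
rewrite theta_coefD !theta_coefZ theta_coef1 theta_coef_theta.
case: n => [|[|n]]; last by rewrite theta_coef_ge2 //= !mulr0 addr0.
- by rewrite mulr0 mulr1 addr0.
- by rewrite mulr0 mulr1 add0r.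
Qed.

Fact theta_grP n s : reflect (exists c, s = c *: theta ^+ n) (s \in theta_gr n).
Proof.
apply: (iffP eqP) => [sE|[c ->]]; first by exists (theta_coef s n).
case: n => [|[|n]]; rewrite ?expr0 ?expr1 theta_coefZ.
- by rewrite theta_coef1 mulr1.
- by rewrite theta_coef_theta mulr1.
- by rewrite theta_coef_ge2 // mulr0 scale0r -addn2 exprD theta_sqr mulr0 scaler0.
Qed.

Fact theta_gr_coef n m s : s \in theta_gr n -> m != n -> theta_coef s m = 0.
Proof.
case/theta_grP=> c -> ne_mn; rewrite theta_coefZ.
case: n ne_mn => [|[|n]] ne_mn.
- by rewrite theta_coef1 (negPf ne_mn) mulr0.
- by rewrite expr1 theta_coef_theta (negPf ne_mn) mulr0.
- by rewrite -addn2 exprD theta_sqr mulr0 theta_coef0 mulr0.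
Qed.

Fact theta_gr_submod n : submod_closed (theta_gr n).
Proof.
split=> [|a _ _ /theta_grP[c ->] /theta_grP[c' ->]]; apply/theta_grP.
  by exists 0; rewrite scale0r.
by exists (a * c + c'); rewrite scalerDl scalerA.
Qed.

Fact theta_gr_decomp w : exists s : seq theta_alg,
  (forall i, s`_i \in theta_gr i) /\ w = \sum_(i < size s) s`_i.
Proof.
exists [:: theta_coef w 0 *: 1; theta_coef w 1 *: theta]; split.
  case=> [|[|i]]; apply/theta_grP; [by eexists | by eexists |].
  by exists 0; rewrite scale0r /= nth_nil.
by rewrite !big_ord_recl big_ord0 /= addr0 {1}[w]theta_decomp.
Qed.

Fact theta_gr_direct (s : seq theta_alg) :
  (forall i, s`_i \in theta_gr i) -> \sum_(i < size s) s`_i = 0 ->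
  forall i, s`_i = 0.
Proof.
move=> s_gr s_sum i; have [lt_is | le_si] := ltnP i (size s); last first.
  exact: nth_default.
apply/theta_coefP=> m; rewrite theta_coef0.
have [-> | ne_mi] := eqVneq m i; last exact: theta_gr_coef (s_gr i) ne_mi.
have coef_sum r (F : 'I_r -> theta_alg) :
    theta_coef (\sum_j F j) i = \sum_j theta_coef (F j) i.
  by elim/big_rec2: _ => [|j a b _ <-]; rewrite ?theta_coef0 ?theta_coefD.
have := coef_sum _ (fun j : 'I_(size s) => s`_j).
rewrite s_sum theta_coef0 (bigD1 (Ordinal lt_is)) //= big1 ?addr0 // => j ne_ji.
by apply: theta_gr_coef (s_gr j) _; rewrite eq_sym.
Qed.

Fact theta_mul_gr m n w v :
  w \in theta_gr m -> v \in theta_gr n -> w * v \in theta_gr (m + n)%N.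
Proof.
move=> /theta_grP[a ->] /theta_grP[b ->]; apply/theta_grP; exists (a * b).
by rewrite -scalerAl -scalerAr scalerA exprD.
Qed.

Fact theta_iota_inj : injective theta_iota.
Proof.
move=> a b /theta_coefP/(_ 0%N).
by rewrite /theta_iota /= !theta_coefZ theta_coef1 !mulr1.
Qed.

Fact theta_gr0P w : w \in theta_gr 0 <-> exists a : k^o, w = theta_iota a.
Proof. by split=> [/theta_grP|wP]; last apply/theta_grP. Qed.

Fact theta_d_gr n w : w \in theta_gr n -> (\0 w : theta_alg) \in theta_gr n.+1.
Proof. by move=> _; have [] := theta_gr_submod n.+1. Qed.

Fact theta_leibniz m (w v : theta_alg) : w \in theta_gr m ->
  \0 (w * v) = \0 w * v + (-1) ^+ m * (w * \0 v) :> theta_alg.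
Proof. by move=> _ /=; rewrite mul0r !mulr0 addr0. Qed.

(* The DGA k[theta]/<theta^2> on k, with theta of degree 1 and d = 0. *)
Definition theta_dga : dga k^o :=
  @Dga k k^o theta_alg theta_gr \0 theta_iota theta_gr_submod theta_gr_decomp
    theta_gr_direct theta_mul_gr theta_iota_inj theta_gr0P theta_d_gr
    theta_leibniz (fun=> erefl).

End Theta.

Arguments theta {k}.

(* T, together with the bilinear map t, is a tensor product of U and V. *)
Definition is_tensor (k : fieldType) (U V T : lmodType k)
    (t : {bilinear U -> V -> T}) : Prop :=
  forall (W : lmodType k) (f : {bilinear U -> V -> W}),
    exists2 g : {linear T -> W}, (forall u v, g (t u v) = f u v)
      & forall g' : {linear T -> W}, (forall u v, g' (t u v) = f u v) -> g' =1 g.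

(* The DGA T on A, whose underlying graded vector space is the tensor product of
   k[theta]/<theta^2> and Om via t (with A identified with 1 (x) A), is a central
   extension of Om. In it, w in Om stands for t 1 w and theta for t theta 1. *)
Record is_central_extension (k : fieldType) (A : algType k) (Om T : dga A)
    (t : {bilinear theta_dga k -> Om -> T}) : Prop := IsCentralExtension {
  ce_tensor : is_tensor t;
  ce_gr : forall m n s w,
    s \in dga_gr (theta_dga k) m -> w \in dga_gr Om n ->
    t s w \in dga_gr T (m + n)%N;
  ce_iota : forall a : A, dga_iota T a = t 1 (dga_iota Om a);
  ce_incl : is_dga_map (fun s : theta_dga k => t s 1 : T);
  ce_proj : exists2 p : T -> Om, is_dga_map p
    & (forall w, p (t 1 w) = w) /\ (forall w, p (t theta w) = 0);
  ce_thetaM : forall w, t theta 1 * t 1 w = t theta w;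
  ce_central : forall n w, w \in dga_gr Om n ->
    t theta 1 * t 1 w = (-1) ^+ n * (t 1 w * t theta 1)
}.

(* L_Delta(w, v) for a map Delta of degree 0. *)
Definition L_op (k : fieldType) (A : algType k) (Om : dga A)
    (Delta : Om -> Om) (w v : Om) : Om :=
  Delta (w * v) - Delta w * v - w * Delta v.

(* Main.v *)
(* Write c = lambda / 2. Since theta^2 = 0, d theta = 0 and theta is
   graded-central, products and differentials in the extension are determined by
   those of elements of Om, and both sides of each DGA axiom for such elements
   agree modulo theta. Comparing the coefficients of theta (x |-> theta x is
   injective and c <> 0), associativity is the cocycle identity, d^2 = 0 is
   [Delta, d] = 0, and the Leibniz rule is the formula for L_Delta. Conversely
   the three identities make Om + theta Om a DGA; the unit is still 1 because
   the cocycle identity gives br 1 w = br 1 1 * w, and br 1 1 has degree -1. *)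

Require Import Defs.
From HB Require Import structures.
From mathcomp Require Import all_boot all_order all_algebra.

Set Implicit Arguments.
Unset Strict Implicit.
Unset Printing Implicit Defensive.

Import GRing.Theory.
Local Open Scope ring_scope.

(** The DGA axioms write signs as elements of the algebra; as scalars they pass through linear and
    bilinear maps. *)
Lemma signr_scale (k : fieldType) (V : algType k) m (v : V) :
  (-1) ^+ m * v = (-1) ^+ m *: v.
Proof.
rewrite -[in LHS]signr_odd -[in RHS]signr_odd.
by case: odd; rewrite ?mul1r ?scale1r // mulN1r scaleN1r.
Qed.

(** * Homogeneous components and the grading automorphism *)

Section Grading.
Variables (k : fieldType) (A : algType k) (Om : dga A).
Implicit Types (w v : Om) (F : nat -> Om).

Lemma dga_gr0 n : 0 \in dga_gr Om n.
Proof. by have [] := dga_gr_submod Om n. Qed.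

Lemma dga_grP n (a : k) w v :
  w \in dga_gr Om n -> v \in dga_gr Om n -> a *: w + v \in dga_gr Om n.
Proof. by have [_] := dga_gr_submod Om n; apply. Qed.

Lemma dga_grZ n (a : k) w : w \in dga_gr Om n -> a *: w \in dga_gr Om n.
Proof. by move=> wn; rewrite -[_ *: _]addr0 dga_grP ?dga_gr0. Qed.

Lemma dga_grD n w v :
  w \in dga_gr Om n -> v \in dga_gr Om n -> w + v \in dga_gr Om n.
Proof. by move=> wn vn; rewrite -[w]scale1r dga_grP. Qed.

Lemma dga_grN n w : w \in dga_gr Om n -> - w \in dga_gr Om n.
Proof. by move=> wn; rewrite -scaleN1r dga_grZ. Qed.

Lemma dga_gr_iota a : dga_iota Om a \in dga_gr Om 0.
Proof. by apply/dga_gr0P; exists a. Qed.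

Lemma dga_gr1 : 1 \in dga_gr Om 0.
Proof. by rewrite -(rmorph1 (dga_iota Om)) dga_gr_iota. Qed.

Lemma dga_d1 : dga_d Om 1 = 0.
Proof.
have := dga_leibniz 1 dga_gr1; rewrite expr0 !mul1r mulr1.
by move/esym/(canRL (addrK _)); rewrite subrr.
Qed.

Lemma dga_gr_predP n (a : k) w v :
  w \in dga_gr_pred Om n -> v \in dga_gr_pred Om n ->
  a *: w + v \in dga_gr_pred Om n.
Proof.
case: n => [|n]; last exact: dga_grP.
by rewrite !inE => /eqP-> /eqP->; rewrite scaler0 addr0.
Qed.

Lemma dga_gr_pred0 n : 0 \in dga_gr_pred Om n.
Proof. by case: n => [|n]; rewrite ?inE //= dga_gr0. Qed.

(** Allowing every large enough bound lets two elements be summed over one common range. *)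
Lemma dga_gr_decomp w : exists N F,
  (forall i, F i \in dga_gr Om i)
  /\ forall n, (N <= n)%N -> w = \sum_(i < n) F i.
Proof.
have [s [s_gr ->]] := dga_decomp w; exists (size s), (nth 0 s); split=> // n le_n.
rewrite (big_ord_widen _ _ le_n) big_mkcond; apply: eq_bigr => i _.
by case: ltnP => // ?; rewrite nth_default.
Qed.

(** [F] may be nonzero from [n] on, so [dga_direct] is applied to its truncation [mkseq F n]. *)
Lemma dga_gr_indep F n : (forall i, F i \in dga_gr Om i) ->
  \sum_(i < n) F i = 0 -> forall i, (i < n)%N -> F i = 0.
Proof.
move=> F_gr F0 i lt_in; have := @dga_direct _ _ Om (mkseq F n) _ _ i.
rewrite nth_mkseq //; apply=> [j|].
  have [lt_jn | le_nj] := ltnP j n; first by rewrite nth_mkseq.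
  by rewrite nth_default ?size_mkseq ?dga_gr0.
rewrite size_mkseq -[RHS]F0; apply: eq_bigr => j _; exact: nth_mkseq.
Qed.

Lemma dga_gr_ind (P : Om -> Prop) :
  (forall n w, w \in dga_gr Om n -> P w) ->
  (forall w v, P w -> P v -> P (w + v)) -> forall w, P w.
Proof.
move=> Pgr PD w; have [N [F [F_gr /(_ N (leqnn N)) ->]]] := dga_gr_decomp w.
by apply: big_ind => [|//|i _]; [apply: (Pgr 0%N); exact: dga_gr0 | apply: Pgr].
Qed.

(** A boolean form of [dga_decomp], from which [xchoose] can pick a decomposition. Indices past the
    size need no test, the default [0] being in every piece. *)
Lemma parity_exists w : exists s : seq Om,
  all (fun i => s`_i \in dga_gr Om i) (iota 0 (size s))
  && (w == \sum_(i < size s) s`_i).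
Proof.
have [s [s_gr w_s]] := dga_decomp w; exists s; rewrite -w_s eqxx andbT.
by apply/allP=> i _.
Qed.

(* The grading automorphism w |-> (-1)^|w| w, which lets sign rules be stated
   for elements that need not be homogeneous. *)
Definition parity w : Om :=
  let s := xchoose (parity_exists w) in \sum_(i < size s) (-1) ^+ i *: s`_i.

(** The chosen decomposition does not matter: padded to a common length, two decompositions of one
    element differ by homogeneous terms with sum zero, and these vanish. *)
Lemma parity_sum n F : (forall i, F i \in dga_gr Om i) ->
  parity (\sum_(i < n) F i) = \sum_(i < n) (-1) ^+ i *: F i.
Proof.
move=> F_gr; rewrite /parity; set s := xchoose _.
have /andP[/allP s_gr /eqP s_sum] := xchooseP (parity_exists (\sum_(i < n) F i)).
rewrite -/s in s_gr s_sum.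
have s_gr' i : s`_i \in dga_gr Om i.
  have [lt_is | ?] := ltnP i (size s); first by apply: s_gr; rewrite mem_iota.
  by rewrite nth_default ?dga_gr0.
pose N := maxn n (size s); pose f i := if (i < n)%N then F i else 0.
have f_gr i : f i \in dga_gr Om i by rewrite /f; case: ifP; rewrite ?dga_gr0.
have widenF (a : nat -> k) : \sum_(i < n) a i *: F i = \sum_(i < N) a i *: f i.
  rewrite (big_ord_widen _ (fun i => a i *: F i) (leq_maxl n (size s))) big_mkcond.
  by apply: eq_bigr => i _; rewrite /f; case: ifP; rewrite ?scaler0.
have widens (a : nat -> k) :
    \sum_(i < size s) a i *: s`_i = \sum_(i < N) a i *: s`_i.
  rewrite (big_ord_widen _ (fun i => a i *: s`_i) (leq_maxr n (size s))) big_mkcond.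
  by apply: eq_bigr => i _; case: ltnP => // ?; rewrite nth_default ?scaler0.
have fs0 i : (i < N)%N -> f i - s`_i = 0.
  apply: (@dga_gr_indep (fun i => f i - s`_i)) => [{}i|].
    by rewrite dga_grD ?dga_grN.
  (* Plain sums become sums with coefficients [1], so that [widenF] and [widens] serve both here and
     for the signs. *)
  have one_scale m (G : nat -> Om) : \sum_(j < m) G j = \sum_(j < m) 1 *: G j.
    by apply: eq_bigr => j _; rewrite scale1r.
  rewrite sumrB one_scale -(widenF (fun=> 1)) -one_scale s_sum.
  by rewrite one_scale (widens (fun=> 1)) -one_scale subrr.
rewrite widens widenF; apply: eq_bigr => i _; congr (_ *: _).
by apply/esym/eqP; rewrite -subr_eq0 fs0.
Qed.

Lemma parity_linear : linear parity.
Proof.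
move=> a w v; have [N [F [F_gr wF]]] := dga_gr_decomp w.
have [M [G [G_gr vG]]] := dga_gr_decomp v.
rewrite (wF _ (leq_maxl N M)) (vG _ (leq_maxr N M)) scaler_sumr -big_split /=.
rewrite !parity_sum // (@parity_sum _ (fun i => a *: F i + G i)); last first.
  by move=> i; rewrite dga_grP.
rewrite scaler_sumr -big_split; apply: eq_bigr => i _ /=.
by rewrite scalerDr !scalerA mulrC.
Qed.

HB.instance Definition _ := GRing.isLinear.Build k Om Om _ parity parity_linear.

Lemma parity_gr n w : w \in dga_gr Om n -> parity w = (-1) ^+ n *: w.
Proof.
(* The decomposition of [w] concentrated in degree [n]. *)
move=> wn; pose F i := if i == n then w else 0.
have F_gr i : F i \in dga_gr Om i by rewrite /F; case: eqP => [->|]; rewrite ?dga_gr0.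
have sumF (a : nat -> k) : \sum_(i < n.+1) a i *: F i = a n *: w.
  rewrite big_ord_recr big1 /= => [|i _]; first by rewrite add0r /F eqxx.
  by rewrite /F (ltn_eqF (ltn_ord i)) scaler0.
rewrite -sumF -parity_sum //; congr parity.
by rewrite -[LHS]scale1r -(sumF (fun=> 1)); apply: eq_bigr => i _; rewrite scale1r.
Qed.

Lemma parityM w v : parity (w * v) = parity w * parity v.
Proof.
elim/dga_gr_ind: w => [m w wm | w w' IHw IHw']; last first.
  by rewrite mulrDl !linearD /= IHw IHw' mulrDl.
elim/dga_gr_ind: v => [n v vn | v v' IHv IHv']; last first.
  by rewrite mulrDr !linearD /= IHv IHv' mulrDr.
rewrite (parity_gr (dga_mul_gr wm vn)) (parity_gr wm) (parity_gr vn).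
by rewrite -scalerAl -scalerAr scalerA exprD.
Qed.

End Grading.
Arguments dga_gr1 {k A Om}.

(** * From a central extension to the three identities *)

Section Necessity.
Variables (k : fieldType) (A : algType k) (Om T : dga A).
Variable t : {bilinear theta_dga k -> Om -> T}.
Hypothesis ce : is_central_extension t.

(** Taking the coefficient of [theta] is bilinear, so the universal property turns it into a linear
    left inverse of [t theta]. *)
Lemma tensor_theta_inj : injective (t theta).
Proof.
pose f (s : theta_dga k) (w : Om) : Om := theta_coef s 1 *: w.
have f_bilinear : bilinear_for *:%R *:%R f.
  split=> [w a s s' | s a w w'] /=.
    by rewrite /f theta_coefD theta_coefZ scalerDl scalerA.
  by rewrite /f scalerDr !scalerA mulrC.
pose fM := bilinear_isBilinear.Build _ _ _ _ _ _ f f_bilinear.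
pose fB : {bilinear theta_dga k -> Om -> Om} := HB.pack f fM.
have [g gE _] := ce_tensor ce fB.
by apply: (can_inj (g := g)) => w; rewrite gE /= /f theta_coef_theta scale1r.
Qed.

Lemma thetaE w : t theta w = t theta 1 * t 1 w.
Proof. by rewrite ce_thetaM. Qed.

Lemma theta_theta : t theta 1 * t theta 1 = 0.
Proof.
have [_ [_ tM] _ _] := ce_incl ce.
by rewrite -tM -expr2 theta_sqr linear0l.
Qed.

Lemma one_theta m w : w \in dga_gr Om m ->
  t 1 w * t theta 1 = (-1) ^+ m *: t theta w.
Proof.
move=> wm; rewrite (thetaE w) (ce_central ce wm) -signr_scale mulrA.
by rewrite -signr_odd; case: odd; rewrite ?mulrNN ?mulr1 ?mul1r.
Qed.

(** The inclusion of k[theta] commutes with the differentials, so d theta = 0; the minus sign comes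
    from theta having degree 1. *)
Lemma dga_d_theta w :
  dga_d T (t theta w) = - (t theta 1 * dga_d T (t 1 w)).
Proof.
have [_ _ _ td] := ce_incl ce.
have th1 : t theta 1 \in dga_gr T 1.
  apply: (ce_gr ce (m := 1) (n := 0)); last exact: dga_gr1.
  by apply/theta_grP; exists 1; rewrite scale1r expr1.
by rewrite (thetaE w) (dga_leibniz _ th1) -td /= linear0l mul0r add0r expr1 mulN1r.
Qed.

Variables (c : k) (Delta : {linear Om -> Om}) (br : {bilinear Om -> Om -> Om}).
Hypothesis c_neq0 : c != 0.
Hypothesis tM : forall w v : Om, t 1 w * t 1 v = t 1 (w * v) - c *: t theta (br w v).
Hypothesis td : forall w : Om,
  dga_d T (t 1 w) = t 1 (dga_d Om w) - c *: t theta (Delta w).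

(** The bracket term of the product carries a second factor theta and dies. *)
Lemma theta_mul_one w v : t theta w * t 1 v = t theta (w * v).
Proof.
rewrite (thetaE w) -mulrA tM mulrBr -scalerAr [t theta (br _ _)]thetaE.
by rewrite mulrA theta_theta mul0r scaler0 subr0 -thetaE.
Qed.

Lemma one_mul_theta m w v : w \in dga_gr Om m ->
  t 1 w * t theta v = (-1) ^+ m *: t theta (w * v).
Proof.
by move=> wm; rewrite (thetaE v) mulrA (one_theta wm) -scalerAl theta_mul_one.
Qed.

Lemma dga_d_thetaE (a : k) w :
  dga_d T (a *: t theta w) = - (a *: t theta (dga_d Om w)).
Proof.
rewrite linearZ /= -scalerN; congr (_ *: _).
rewrite dga_d_theta td mulrBr -scalerAr -thetaE [t theta (Delta w)]thetaE.
by rewrite mulrA theta_theta mul0r scaler0 subr0.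
Qed.

(** The comparison of theta-coefficients that ends each of the three derivations below. *)
Lemma scale_theta_inj w v : c *: t theta w = c *: t theta v -> w = v.
Proof. by move/(scalerI c_neq0)/tensor_theta_inj. Qed.

Lemma bracket_cocycle m (w v z : Om) : w \in dga_gr Om m ->
  br (w * v) z + br w v * z = br w (v * z) + (-1) ^+ m * (w * br v z).
Proof.
move=> wm; apply: scale_theta_inj; rewrite signr_scale !linearD /= !linearZ /=.
(* Both bracketings have the same part free of theta, [t 1 (w * v * z)]; what remains is [- c] theta
   times the two sides of the identity. *)
have := mulrA (t 1 w) (t 1 v) (t 1 z).
rewrite !tM mulrBl mulrBr !tM -scalerAl -scalerAr theta_mul_one.
rewrite (one_mul_theta _ wm) mulrA -!addrA -!opprD.
by move/addrI/oppr_inj=> <-; rewrite scalerA [_ * c]mulrC -scalerA.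
Qed.

Lemma Delta_d_comm w : Delta (dga_d Om w) - dga_d Om (Delta w) = 0.
Proof.
apply: scale_theta_inj; rewrite linear0r scaler0 linearB /= scalerBr.
have := dga_dd (t 1 w); rewrite td linearB /= td dga_d_thetaE dga_dd.
rewrite linear0r sub0r opprK addrC => /eqP.
by rewrite subr_eq0 => /eqP->; rewrite subrr.
Qed.

Lemma L_op_bracket m (w v : Om) : w \in dga_gr Om m ->
  L_op Delta w v
    = dga_d Om (br w v) + br (dga_d Om w) v + (-1) ^+ m * br w (dga_d Om v).
Proof.
move=> wm; apply: scale_theta_inj; rewrite /L_op.
have t1w : t 1 w \in dga_gr T m.
  by apply: (ce_gr ce (m := 0) (n := m)) => //; exact: dga_gr1.
have := dga_leibniz (t 1 v) t1w.
rewrite !signr_scale !tM !td linearB /= td dga_d_thetaE opprK.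
rewrite (dga_leibniz _ wm) signr_scale.
rewrite mulrBl mulrBr !tM -scalerAl -scalerAr theta_mul_one.
rewrite (one_mul_theta _ wm) !linearD /= !linearZ /= !linearN /=.
(* Terms 1 and 4 make up [t 1] of d(wv) and cancel; 2 and 5 are the brackets, 3 and 6 the [Delta]
   terms. *)
rewrite [X in _ = X -> _](AC (3*3) ((1*4)*((2*5)*(3*6)))) -[X in X = _ -> _]addrA.
move/addrI; rewrite addrC => /(canRL (subKr _)) ->.
(* In the term [w * Delta v] the Leibniz sign meets the sign of moving theta past [w], and the two
   cancel. *)
rewrite !scalerA -mulrA -expr2 sqrr_sign mulr1 [_ * c]mulrC.
by rewrite !opprD !opprK -addrA -opprD [_ + (_ + _ + (_ + _))]addrA addrK addrA.
Qed.

End Necessity.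

(** * From the three identities to an algebra structure on Om + theta Om *)

Section Sufficiency.
Variables (k : fieldType) (A : algType k) (Om : dga A).
Variables (c : k) (Delta : {linear Om -> Om}) (br : {bilinear Om -> Om -> Om}).
Hypothesis Delta_gr : forall n w, w \in dga_gr Om n -> Delta w \in dga_gr Om n.
Hypothesis br_gr : forall m n w v, w \in dga_gr Om m -> v \in dga_gr Om n ->
  br w v \in dga_gr_pred Om (m + n)%N.
Hypothesis Delta_d : forall w : Om, Delta (dga_d Om w) - dga_d Om (Delta w) = 0.
Hypothesis br_cocycle : forall m (w v z : Om), w \in dga_gr Om m ->
  br (w * v) z + br w v * z = br w (v * z) + (-1) ^+ m * (w * br v z).
Hypothesis L_br : forall m (w v : Om), w \in dga_gr Om m ->
  L_op Delta w v
    = dga_d Om (br w v) + br (dga_d Om w) v + (-1) ^+ m * br w (dga_d Om v).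

(** Both sides are additive in [w], so the homogeneous case suffices. This form is needed for
    associativity on arbitrary elements. *)
Lemma bracket_parity (w v z : Om) :
  br (w * v) z + br w v * z = br w (v * z) + parity w * br v z.
Proof.
elim/dga_gr_ind: w => [m w wm | w w' IHw IHw'].
  by rewrite (br_cocycle v z wm) (parity_gr wm) signr_scale scalerAl.
rewrite mulrDl linearD /= !linearDl !mulrDl addrACA IHw IHw'.
by rewrite [LHS](AC (2*2) ((1*3)*(2*4))).
Qed.

Lemma bracket_gr0 w v : w \in dga_gr Om 0 -> v \in dga_gr Om 0 -> br w v = 0.
Proof. by move=> w0 v0; apply/eqP; have := br_gr w0 v0; rewrite inE. Qed.

Lemma bracket1l w : br 1 w = 0.
Proof.
have := br_cocycle 1 w dga_gr1; rewrite expr0 !mul1r.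
by rewrite (bracket_gr0 dga_gr1 dga_gr1) mul0r => /addrI.
Qed.

(** The cocycle identity for [w], 1, 1, where the last term vanishes by [bracket1l]. *)
Lemma bracket1r w : br w 1 = 0.
Proof.
have := bracket_parity w 1 1; rewrite !mulr1 bracket1l mulr0.
by move/addrI.
Qed.

(** At the pair 1, 1 the left side is [- Delta 1], while the right side vanishes since d 1 = 0 and
    [br 1 1 = 0]. *)
Lemma Delta1 : Delta 1 = 0.
Proof.
have := L_br 1 dga_gr1; rewrite /L_op dga_d1 bracket1l linear0 linear0l.
rewrite linear0r mulr0 !addr0 !mulr1 !mul1r subrr sub0r.
by move/eqP; rewrite oppr_eq0 => /eqP.
Qed.

(* The pair (w, x) stands for w + theta x, and w theta = (-1)^|w| theta w. *)
Definition ext_type : Type := (Om * Om)%type.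
HB.instance Definition _ := GRing.Lmodule.on ext_type.
Implicit Types x y z : ext_type.

Definition ext_one : ext_type := (1, 0).
(** [parity] arises from moving the theta of [y] to the left past [x.1]; the product of the two
    theta parts is killed by theta^2 = 0. *)
Definition ext_mul x y : ext_type :=
  (x.1 * y.1, x.2 * y.1 + parity x.1 * y.2 - c *: br x.1 y.1).

Lemma parity1 : parity (1 : Om) = 1.
Proof. by rewrite (parity_gr dga_gr1) scale1r. Qed.

Fact ext_mulA : associative ext_mul.
Proof.
move=> x y z; congr (_, _); rewrite /= ?mulrA //.
rewrite !mulrBr !mulrBl !mulrDl mulrDr parityM !mulrA -!scalerAl -!scalerAr.
(* Apart from this multiple of the cocycle identity, the theta components agree by associativity in
   [Om] and multiplicativity of [parity]. *)
have /(congr1 ( *:%R c)) := bracket_parity x.1 y.1 z.1; rewrite !scalerDr => E.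
rewrite !addrA [RHS](ACl (1*2*4*(5*3))) /= -opprD E.
by rewrite -[LHS]addrA -opprD [X in _ - X = _]addrC.
Qed.

Fact ext_mul1r : left_id ext_one ext_mul.
Proof.
case=> w v; congr (_, _); rewrite /= ?mul1r //.
by rewrite mul0r parity1 mul1r bracket1l scaler0 add0r subr0.
Qed.

Fact ext_mulr1 : right_id ext_one ext_mul.
Proof.
case=> w v; congr (_, _); rewrite /= ?mulr1 //.
by rewrite mulr0 bracket1r scaler0 addr0 subr0.
Qed.

Fact ext_mulDl : left_distributive ext_mul +%R.
Proof.
move=> x y z; congr (_, _); rewrite /= ?mulrDl // linearD /= linearDl mulrDl.
by rewrite scalerDr opprD [RHS](AC (3*3) ((1*4)*(2*5)*(3*6))).
Qed.

Fact ext_mulDr : right_distributive ext_mul +%R.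
Proof.
move=> x y z; congr (_, _); rewrite /= ?mulrDr // linearD /= scalerDr opprD.
by rewrite [RHS](AC (3*3) ((1*4)*(2*5)*(3*6))).
Qed.

Fact ext_1neq0 : ext_one != 0.
Proof. by rewrite xpair_eqE oner_eq0. Qed.

HB.instance Definition _ := GRing.Zmodule_isNzRing.Build ext_type
  ext_mulA ext_mul1r ext_mulr1 ext_mulDl ext_mulDr ext_1neq0.

Fact ext_scaleAl (a : k) x y : a *: (x * y) = (a *: x : ext_type) * y.
Proof.
congr (_, _); rewrite /= ?scalerAl // [parity (_ *: _)]linearZ linearZl_LR /=.
by rewrite scalerBr scalerDr !scalerAl !scalerA mulrC.
Qed.

Fact ext_scaleAr (a : k) x y : a *: (x * y) = x * (a *: y : ext_type).
Proof.
congr (_, _); rewrite /= ?scalerAr // linearZr_LR /=.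
by rewrite scalerBr scalerDr !scalerAr !scalerA mulrC.
Qed.

HB.instance Definition _ := GRing.Lmodule_isLalgebra.Build k ext_type ext_scaleAl.
HB.instance Definition _ :=
  GRing.LSemiAlgebra_isSemiAlgebra.Build k ext_type ext_scaleAr.

(** * Grading, differential and DGA axioms of the extension *)

Definition ext_alg : algType k := ext_type.

Definition ext_gr n : {pred ext_alg} :=
  [pred x : ext_type | (x.1 \in dga_gr Om n) && (x.2 \in dga_gr_pred Om n)].

(** The sign of the second component is that of d(theta x) = - theta dx. *)
Definition ext_d (x : ext_alg) : ext_alg :=
  (dga_d Om x.1, - dga_d Om x.2 - c *: Delta x.1).

Definition ext_iota (a : A) : ext_alg := (dga_iota Om a, 0).

Fact ext_d_linear : linear ext_d.
Proof.
move=> a x y; congr (_, _); rewrite /= !linearP //=.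
by rewrite scalerDr addrACA.
Qed.
HB.instance Definition _ := GRing.isLinear.Build k ext_alg ext_alg _ ext_d ext_d_linear.

Fact ext_iota_linear : linear ext_iota.
Proof. by move=> a x y; congr (_, _); rewrite /= ?linearP //= scaler0 addr0. Qed.
HB.instance Definition _ :=
  GRing.isLinear.Build k A ext_alg _ ext_iota ext_iota_linear.

(** [A] sits in degree 0, where a bracket of degree -1 vanishes, so its product is undeformed. *)
Fact ext_iota_monoid_morphism : monoid_morphism ext_iota.
Proof.
split=> [|a b]; congr (_, _); rewrite /= ?rmorph1 ?rmorphM //.
by rewrite mul0r mulr0 addr0 bracket_gr0 ?dga_gr_iota // scaler0 subr0.
Qed.
HB.instance Definition _ :=
  GRing.isMonoidMorphism.Build A ext_alg ext_iota ext_iota_monoid_morphism.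

Fact ext_gr_submod n : submod_closed (ext_gr n).
Proof.
split=> [|a x y /andP[x1 x2] /andP[y1 y2]]; apply/andP; split.
- exact: dga_gr0.
- exact: dga_gr_pred0.
- exact: dga_grP.
- exact: dga_gr_predP.
Qed.

Fact ext_decomp (x : ext_alg) : exists s : seq ext_alg,
  (forall i, s`_i \in ext_gr i) /\ x = \sum_(i < size s) s`_i.
Proof.
have [N [F [F_gr xF]]] := dga_gr_decomp x.1.
have [M [G [G_gr xG]]] := dga_gr_decomp x.2.
(* Theta raises degrees by one, so the components of [x.2] are shifted; this also accounts for the
   successor in the length below. *)
pose H i : ext_alg := (F i, if i is j.+1 then G j else 0).
exists (mkseq H (maxn N M).+1); split=> [i|].
  have [lt_i | le_i] := ltnP i (maxn N M).+1; last first.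
    by rewrite nth_default ?size_mkseq //; have [] := ext_gr_submod i.
  rewrite nth_mkseq //; apply/andP; split; first exact: F_gr.
  by case: (i) => [|j]; [rewrite inE /= | exact: G_gr].
rewrite size_mkseq (eq_bigr (fun i : 'I__ => H i)); last first.
  by move=> i _; rewrite nth_mkseq.
rewrite [LHS]surjective_pairing [RHS]surjective_pairing.
congr (_, _).
  rewrite (raddf_sum fst) /= -xF //.
  exact: leq_trans (leq_maxl N M) _.
rewrite (raddf_sum snd) big_ord_recl /= add0r.
by rewrite -xG // leq_maxr.
Qed.

Fact ext_direct (s : seq ext_alg) : (forall i, s`_i \in ext_gr i) ->
  \sum_(i < size s) s`_i = 0 -> forall i, s`_i = 0.
Proof.
move=> s_gr s0 i; have [lt_is | ?] := ltnP i (size s); last exact: nth_default.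
have s1 : (s`_i).1 = 0.
  apply: (@dga_gr_indep _ _ Om (fun i => (s`_i).1) (size s)) => // [j|].
    by have /andP[] := s_gr j.
  by rewrite -(raddf_sum fst) s0.
have s2 : (s`_i).2 = 0.
  (* In degree 0 the theta component is zero by definition of the grading; the others form a graded
     family one term shorter. *)
  case: i lt_is {s1} => [|i] lt_is; first by have /andP[_ /eqP] := s_gr 0.
  apply: (@dga_gr_indep _ _ Om (fun i => (s`_i.+1).2) (size s).-1); last first.
  - by rewrite ltn_predRL.
  - have /(congr1 snd) := s0; rewrite (raddf_sum snd).
    case: (size s) lt_is => // n _; rewrite big_ord_recl /=.
    by have /andP[_ /eqP->] := s_gr 0; rewrite add0r.
  - by move=> j; have /andP[] := s_gr j.+1.
by rewrite [LHS]surjective_pairing s1 s2.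
Qed.

Fact ext_mul_gr m n x y :
  x \in ext_gr m -> y \in ext_gr n -> x * y \in ext_gr (m + n)%N.
Proof.
move=> /andP[x1 x2] /andP[y1 y2]; apply/andP; split; first exact: dga_mul_gr.
rewrite /= addrC -scaleNr; apply: dga_gr_predP; first exact: br_gr.
rewrite -[_ + _]addrC (parity_gr x1) -scalerAl; apply: dga_gr_predP.
  (* A factor of degree 0 has no theta part, so the predecessor degree is only computed for a
     positive one. *)
  case: n y1 y2 => [|n] y1 y2; last by rewrite addnS; exact: dga_mul_gr.
  by move/eqP: y2 => ->; rewrite mulr0 dga_gr_pred0.
case: m x1 x2 => [|m] x1 x2; last exact: dga_mul_gr.
by move/eqP: x2 => ->; rewrite mul0r dga_gr_pred0.
Qed.

Fact ext_iota_inj : injective ext_iota.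
Proof. by move=> a b [/dga_iota_inj]. Qed.

Fact ext_gr0P x : x \in ext_gr 0 <-> exists a : A, x = ext_iota a.
Proof.
split=> [/andP[/dga_gr0P[a x1] /eqP x2]|[a ->]].
  by exists a; rewrite [x]surjective_pairing x1 x2.
by apply/andP; rewrite dga_gr_iota dga_gr_pred0.
Qed.

Fact ext_d_gr n x : x \in ext_gr n -> ext_d x \in ext_gr n.+1.
Proof.
move=> /andP[x1 x2]; apply/andP; split; first exact: dga_d_gr.
rewrite /= dga_grD ?dga_grN ?dga_grZ ?Delta_gr //.
case: n x1 x2 => [|n] _ x2; last exact: dga_d_gr.
by move/eqP: x2 => ->; rewrite linear0 dga_gr0.
Qed.

Fact ext_leibniz m x y : x \in ext_gr m ->
  ext_d (x * y) = ext_d x * y + (-1) ^+ m * (x * ext_d y).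
Proof.
move=> /andP[x1 x2]; rewrite signr_scale.
(* [x.2] has degree m - 1, hence the sign opposite to that of [x.1]; for m = 0 it is zero. *)
have dx2 v :
    dga_d Om (x.2 * v) =
      dga_d Om x.2 * v - (-1) ^+ m *: (x.2 * dga_d Om v).
  case: (m) x2 => [/eqP->|n x2].
    by rewrite linear0 !mul0r linear0 scaler0 subrr.
  by rewrite (dga_leibniz _ x2) signr_scale exprS mulN1r scaleNr opprK.
have := L_br y.1 x1; rewrite signr_scale /L_op => L.
congr (_, _); rewrite /= ?(dga_leibniz _ x1) ?signr_scale //.
rewrite (parity_gr x1) (parity_gr (dga_d_gr x1)).
rewrite [dga_d Om (_ - _)]linearB [dga_d Om (_ + _)]linearD /= dx2.
rewrite -scalerAl [dga_d Om (_ *: (_ * _))]linearZ [dga_d Om (_ *: br _ _)]linearZ /=.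
rewrite (dga_leibniz _ x1) signr_scale.
(* The hypothesis on [L_op] is solved for [Delta (x.1 * y.1)]. Its term d(br) then cancels the one
   obtained by differentiating the product. *)
move: L => /(canRL (subrK _))/(canRL (subrK _)) ->.
have SS u : (-1) ^+ m *: ((-1) ^+ m *: u) = u :> Om.
  by rewrite scalerA -expr2 sqrr_sign scale1r.
rewrite exprS mulN1r scaleNr mulrBr mulrN !mulrBl mulNr -!scalerAl -!scalerAr.
rewrite !scalerDr !scalerN !SS [_ *: (c *: _)]scalerA [_ * c]mulrC -scalerA.
rewrite !opprD !opprK !mulNr -!scalerAl !addrA addrK.
by rewrite [RHS](ACl (1*5*3*6*4*8*7*2)).
Qed.

Fact ext_dd x : ext_d (ext_d x) = 0.
Proof.
congr (_, _); rewrite /= ?dga_dd // linearB linearN /= dga_dd oppr0 add0r.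
rewrite [dga_d Om (_ *: _)]linearZ opprK /= -scalerBr.
by have /eqP := Delta_d x.1; rewrite subr_eq0 => /eqP->; rewrite subrr scaler0.
Qed.

Definition ext_dga : dga A :=
  @Dga k A ext_alg ext_gr ext_d ext_iota ext_gr_submod ext_decomp ext_direct
    ext_mul_gr ext_iota_inj ext_gr0P ext_d_gr ext_leibniz ext_dd.

(** * Tensor product structure and the axioms of a central extension *)

Definition ext_tensor (s : theta_dga k) (w : Om) : ext_dga :=
  (theta_coef s 0 *: w, theta_coef s 1 *: w).

Fact ext_tensor_bilinear : bilinear_for *:%R *:%R ext_tensor.
Proof.
split=> [w a s s' | s a w w'] /=; congr (_, _); rewrite /=.
- by rewrite theta_coefD theta_coefZ scalerDl scalerA.
- by rewrite theta_coefD theta_coefZ scalerDl scalerA.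
- by rewrite scalerDr !scalerA mulrC.
- by rewrite scalerDr !scalerA mulrC.
Qed.
HB.instance Definition _ := bilinear_isBilinear.Build k (theta_dga k) Om ext_dga
  _ _ ext_tensor ext_tensor_bilinear.

Definition ext_t : {bilinear theta_dga k -> Om -> ext_dga} := ext_tensor.

Lemma ext_t1 w : ext_t 1 w = (w, 0) :> ext_type.
Proof.
by congr (_, _); rewrite !theta_coef1 ?scale1r ?scale0r.
Qed.

Lemma ext_t_theta w : ext_t theta w = (0, w) :> ext_type.
Proof.
by congr (_, _); rewrite !theta_coef_theta ?scale1r ?scale0r.
Qed.

Lemma ext_tE x : x = ext_t 1 x.1 + ext_t theta x.2.
Proof.
rewrite ext_t1 ext_t_theta [LHS]surjective_pairing.
by congr (_, _); rewrite /= ?addr0 ?add0r.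
Qed.

(** Since [1] and [theta] form a basis of k[theta], a bilinear [f] amounts to the two linear maps
    [f 1] and [f theta], one for each component. *)
Lemma ext_is_tensor : is_tensor ext_t.
Proof.
move=> W f; pose g (x : ext_dga) : W := f 1 x.1 + f theta x.2.
have g_linear : linear g.
  by move=> a x y; rewrite /g !linearP /= scalerDr addrACA.
pose gM := GRing.isLinear.Build _ _ _ _ g g_linear.
pose gL : {linear ext_dga -> W} := HB.pack g gM.
exists gL => [s w | g' g'E x].
  rewrite /= /g /= !linearZ /= -!linearZl_LR -linearDl /=.
  by rewrite -theta_decomp.
by rewrite [x in LHS]ext_tE linearD /= !g'E.
Qed.

Lemma ext_t_gr m n s w : s \in theta_gr m -> w \in dga_gr Om n ->
  ext_t s w \in ext_gr (m + n).
Proof.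
move=> sm wn; apply/andP; split; rewrite /=.
  case: m sm => [|m] sm; first by rewrite dga_grZ.
  by rewrite (theta_gr_coef sm) // scale0r dga_gr0.
case: m sm => [|[|m]] sm; last 2 first.
- by rewrite dga_grZ.
- by rewrite (theta_gr_coef sm) // scale0r dga_gr_pred0.
by rewrite (theta_gr_coef sm) // scale0r dga_gr_pred0.
Qed.

Lemma ext_t_theta_mul w : ext_t theta 1 * ext_t 1 w = ext_t theta w.
Proof.
rewrite ext_t_theta ext_t1 ext_t_theta; congr (_, _); rewrite /= ?mul0r //.
by rewrite linear0 mul0r mul1r linear0l scaler0 addr0 subr0.
Qed.

Lemma ext_t_mul_theta w : ext_t 1 w * ext_t theta 1 = ext_t theta (parity w).
Proof.
rewrite ext_t_theta ext_t1 ext_t_theta; congr (_, _); rewrite /= ?mulr0 //.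
by rewrite mulr1 add0r linear0r scaler0 subr0.
Qed.

Lemma ext_t_incl : is_dga_map (fun s : theta_dga k => ext_t s 1 : ext_dga).
Proof.
have t11 : ext_t 1 1 = 1 by rewrite ext_t1.
split.
- by move=> a s s'; rewrite linearPl.
- split=> // s s'.
  (* Expanding in the basis [1], [theta] reduces multiplicativity to theta squared being zero in the
     extension. *)
  rewrite [s]theta_decomp [s']theta_decomp mulrDl !mulrDr.
  rewrite -!scalerAl -!scalerAr !mul1r !mulr1 -expr2 theta_sqr !scaler0 addr0.
  rewrite !linearDl /= !linearZl_LR /= t11 mulrDl !mulrDr.
  rewrite -!scalerAl -!scalerAr !mul1r !mulr1.
  have -> : ext_t theta 1 * ext_t theta 1 = 0 :> ext_alg.
    rewrite ext_t_theta; congr (_, _); rewrite /= ?mul0r //.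
    by rewrite linear0 mul0r mulr0 addr0 linear0l scaler0 subr0.
  by rewrite !scaler0 addr0.
- by move=> n s sn; rewrite -[n]addn0; apply: ext_t_gr => //; apply: dga_gr1.
- move=> s; rewrite /= linear0l; congr (_, _); rewrite /=.
    by rewrite [dga_d Om _]linearZ /= dga_d1 scaler0.
  (* The differential of k[theta] is zero, so the image must be closed; its theta component vanishes
     because d 1 = 0 and [Delta 1 = 0]. *)
  rewrite [dga_d Om _]linearZ [Delta _]linearZ /= dga_d1 Delta1.
  by rewrite !scaler0 oppr0 addr0.
Qed.

Lemma ext_is_central_extension : is_central_extension ext_t.
Proof.
split.
- exact: ext_is_tensor.
- exact: ext_t_gr.
- by move=> a; rewrite ext_t1.
- exact: ext_t_incl.
- exists (fun x : ext_dga => (x : ext_type).1).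
    by split=> // n x /andP[].
  by split=> w; rewrite ?ext_t1 ?ext_t_theta.
- exact: ext_t_theta_mul.
- move=> n w wn; rewrite ext_t_theta_mul ext_t_mul_theta (parity_gr wn).
  by rewrite signr_scale linearZ scalerA -expr2 sqrr_sign scale1r.
Qed.

Lemma ext_t_mul w v :
  ext_t 1 w * ext_t 1 v = ext_t 1 (w * v) - c *: ext_t theta (br w v).
Proof.
rewrite ext_t_theta !ext_t1; congr (_, _) => /=.
  by rewrite scaler0 subr0.
by rewrite mul0r mulr0 addr0 -scalerN.
Qed.

Lemma ext_t_d w :
  dga_d ext_dga (ext_t 1 w) = ext_t 1 (dga_d Om w) - c *: ext_t theta (Delta w).
Proof.
rewrite ext_t_theta !ext_t1; congr (_, _) => /=.
  by rewrite scaler0 subr0.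
by rewrite linear0 oppr0.
Qed.

End Sufficiency.

Unset Implicit Arguments.

Theorem proposition3p2 (k : fieldType) (k_char : 2%N \notin [pchar k])
    (A : algType k) (Om : dga A) (lambda : k) (lambda_neq0 : lambda != 0)
    (Delta : {linear Om -> Om})
    (Delta_gr : forall n w, w \in dga_gr Om n -> Delta w \in dga_gr Om n)
    (br : {bilinear Om -> Om -> Om})
    (br_gr : forall m n w v, w \in dga_gr Om m -> v \in dga_gr Om n ->
       br w v \in dga_gr_pred Om (m + n)%N) :
  (exists (T : dga A) (t : {bilinear theta_dga k -> Om -> T}),
     [/\ is_central_extension t,
         forall w v : Om,
           t 1 w * t 1 v = t 1 (w * v) - (lambda / 2%:R) *: t theta (br w v)
       & forall w : Om,
           dga_d T (t 1 w)
             = t 1 (dga_d Om w) - (lambda / 2%:R) *: t theta (Delta w)])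
  <->
  [/\ forall w : Om, Delta (dga_d Om w) - dga_d Om (Delta w) = 0,
      forall m (w v z : Om), w \in dga_gr Om m ->
        br (w * v) z + br w v * z = br w (v * z) + (-1) ^+ m * (w * br v z)
    & forall m (w v : Om), w \in dga_gr Om m ->
        L_op Delta w v
          = dga_d Om (br w v) + br (dga_d Om w) v
            + (-1) ^+ m * br w (dga_d Om v)].
Proof.
(* If 2 were zero in [k], [lambda / 2%:R] would take the default value 0 and theta-coefficients
   could not be compared. *)
have two_neq0 : 2%:R != 0 :> k.
  by apply: contra k_char => two0; rewrite inE /= two0.
have c_neq0 : lambda / 2%:R != 0 by rewrite mulf_neq0 ?invr_neq0.
split=> [[T [t [ce tM td]]] | [Delta_d br_cocycle L_br]].
  split.
  - exact: (Delta_d_comm ce c_neq0 td).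
  - exact: (bracket_cocycle ce c_neq0 tM).
  - exact: (L_op_bracket ce c_neq0 tM td).
exists (ext_dga (lambda / 2%:R) Delta_gr br_gr Delta_d br_cocycle L_br).
exists (ext_t (lambda / 2%:R) Delta_gr br_gr Delta_d br_cocycle L_br).
split.
- exact: ext_is_central_extension.
- exact: ext_t_mul.
- exact: ext_t_d.
Qed.
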